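(* Let $m\ge n\ge 1$ and let $X,Y\in \mathsf{M}_{m\times n}(\mathbb{R})$ be nonzero. The Real Normal Procrustes Problem of determining $$A^\star\in \operatorname*{argmin}_{A\in\mathcal{N}_{\mathbb{R}}}\ \|AX-Y\|_F^2$$ is equivalent to determining $$Q^\star\in\operatorname*{argmax}_{Q\in \mathrm{O}(m)} g(Q),$$ where $$g(Q)=\sum_{i=1}^{\lfloor m/2\rfloor}\max\left\{\frac{\alpha_i^2+\beta_i^2}{\phi_{2i-1}+\phi_{2i}},\ \frac{\gamma_{2i-1}^2}{\phi_{2i-1}}+\frac{\gamma_{2i}^2}{\phi_{2i}}\right\}+\frac{\gamma_m^2}{\phi_m}=\|\Delta_Q^\star Q^{\mathsf T}X\|_F^2,$$ with the convention that any term with a vanishing denominator equals zero, and the final term present only if $m$ is odd. An optimal $A^\star=Q^\star\Delta^\star_{Q^\star}(Q^\star)^{\mathsf T}$ is real and normal, where $\Delta^\star_{Q^\star}$ is the optimal block diagonal matrix $\Delta^\star_Q$ defined in the context, taken at $Q=Q^\star$.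
   Context: $\mathsf{M}_{m\times n}(\mathbb{R})$ is the set of real $m\times n$ matrices, $\mathsf{M}_m(\mathbb{R})=\mathsf{M}_{m\times m}(\mathbb{R})$, $\|\cdot\|_F$ is the Frobenius norm, $^{\mathsf T}$ denotes the transpose, and $\mathrm{O}(m)$ is the set of real orthogonal $m\times m$ matrices. $\mathcal{N}_{\mathbb{R}}=\{B\in\mathsf{M}_m(\mathbb{R}) : B^{\mathsf T}B=BB^{\mathsf T}\}$ is the set of real normal matrices. For a matrix $M$, $(M)_i$ denotes its $i$th row (a row vector). For fixed $X,Y$ and $Q\in\mathrm{O}(m)$ (dependence on $Q$ is suppressed), define for $1\le j\le m$ and $1\le i\le\lfloor m/2\rfloor$ $$\phi_j:=\|(Q^{\mathsf T}X)_j\|_F^2,\qquad \gamma_j:=(Q^{\mathsf T}Y)_j(Q^{\mathsf T}X)_j^{\mathsf T},$$ $$\alpha_i:=(Q^{\mathsf T}X)_{2i-1}(Q^{\mathsf T}Y)_{2i-1}^{\mathsf T}+(Q^{\mathsf T}X)_{2i}(Q^{\mathsf T}Y)_{2i}^{\mathsf T},$$ $$\beta_i:=(Q^{\mathsf T}X)_{2i}(Q^{\mathsf T}Y)_{2i-1}^{\mathsf T}-(Q^{\mathsf T}X)_{2i-1}(Q^{\mathsf T}Y)_{2i}^{\mathsf T}.$$ For a real $2\times2$ matrix $\Delta_i$ in block position $i$ put $$\rho(\Delta_i):=\left\|\Delta_i\begin{bmatrix}(Q^{\mathsf T}X)_{2i-1}\\(Q^{\mathsf T}X)_{2i}\end{bmatrix}-\begin{bmatrix}(Q^{\mathsf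 T}Y)_{2i-1}\\(Q^{\mathsf T}Y)_{2i}\end{bmatrix}\right\|_F^2.$$ Set $(a_i^\star,b_i^\star)=\left(\frac{\alpha_i}{\phi_{2i-1}+\phi_{2i}},\frac{\beta_i}{\phi_{2i-1}+\phi_{2i}}\right)$ if $\phi_{2i-1}+\phi_{2i}\ne0$ and $(a_i^\star,b_i^\star)=(0,0)$ otherwise. Set $\lambda_j^\star=\gamma_j/\phi_j$ if $(Q^{\mathsf T}X)_j\neq0$ and $\lambda_j^\star=0$ otherwise. Let $$\Psi_i^\star=\begin{bmatrix}a_i^\star&b_i^\star\\-b_i^\star&a_i^\star\end{bmatrix},\qquad \Omega_i^\star=\begin{bmatrix}\lambda_{2i-1}^\star&0\\0&\lambda_{2i}^\star\end{bmatrix},$$ and let $\Delta_i^\star=\Psi_i^\star$ if $\rho(\Psi_i^\star)<\rho(\Omega_i^\star)$ and $\Delta_i^\star=\Omega_i^\star$ if $\rho(\Psi_i^\star)\ge\rho(\Omega_i^\star)$. Finally, $\Delta_Q^\star:=\operatorname{diag}(\Delta_1^\star,\dots,\Delta_{\lfloor m/2\rfloor}^\star)$ if $m$ is even and $\Delta_Q^\star:=\operatorname{diag}(\Delta_1^\star,\dots,\Delta_{\lfloor m/2\rfloor}^\star,\lambda_m^\star)$ if $m$ is odd. *)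

(* Defs.v *)
From HB Require Import structures.
From mathcomp Require Import all_boot all_order all_algebra.
From mathcomp Require Import all_classical all_reals.

Set Implicit Arguments.
Unset Strict Implicit.
Unset Printing Implicit Defensive.

Import Order.TTheory GRing.Theory Num.Theory.

Local Open Scope ring_scope.
Local Open Scope classical_set_scope.

Definition frobenius (R : realType) (m n : nat) (A : 'M[R]_(m, n)) : R :=
  Num.sqrt (\sum_i \sum_j A i j ^+ 2).

Definition orthogonal_mx (R : realType) (m : nat) : set 'M[R]_m :=
  [set Q | Q^T *m Q = 1%:M /\ Q *m Q^T = 1%:M].

Definition normal_mx (R : realType) (m : nat) : set 'M[R]_m :=
  [set B | B^T *m B = B *m B^T].

(* Sets of minimizers and maximizers; they may be empty. *)
Definition argmin (R : realType) (T : Type) (S : set T) (f : T -> R) : set T :=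
  [set x | S x /\ forall y, S y -> f x <= f y].

Definition argmax (R : realType) (T : Type) (S : set T) (f : T -> R) : set T :=
  [set x | S x /\ forall y, S y -> f y <= f x].

(* Rows are numbered from 0: block [i] consists of the rows [blk i 0 = 2i] and
   [blk i 1 = 2i+1], that is, of rows 2i-1 and 2i when both blocks and rows are
   numbered from 1. *)
Fact blk_subproof (m : nat) (i : 'I_(m./2)) (p : 'I_2) : (i.*2 + p < m)%N.
Proof.
have le2 : (i.+1.*2 <= m)%N.
  apply: (@leq_trans m./2.*2); first by rewrite leq_double.
  by rewrite -[leqRHS]odd_double_half leq_addl.
apply: leq_trans le2; rewrite doubleS -addnS -[leqRHS]addn2 leq_add2l.
exact: ltn_ord.
Qed.

Definition blk (m : nat) (i : 'I_(m./2)) (p : 'I_2) : 'I_m :=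
  Ordinal (blk_subproof i p).

Definition mx2 (R : realType) (a b c d : R) : 'M[R]_2 :=
  @block_mx R 1 1 1 1 a%:M b%:M c%:M d%:M.

(* diag(D 0, ..., D (m/2 - 1)) for even [m], and
   diag(D 0, ..., D (m/2 - 1), l (m - 1)) for odd [m].  [insub r./2] is [None]
   only for the last row of an odd-sized matrix, so only that entry of [l] is
   used, and none is when [m] is even. *)
Definition block_diag (R : realType) (m : nat) (D : 'I_(m./2) -> 'M[R]_2)
    (l : 'I_m -> R) : 'M[R]_m :=
  \matrix_(r, s)
    if r./2 != s./2 then 0
    else if insub r./2 is Some i then D i (inord (odd r)) (inord (odd s))
    else l r.

(* The block diagonal shape of the real normal form of a normal matrix. *)
Definition normal_block_form (R : realType) (m : nat) : set 'M[R]_m :=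
  [set M | exists (D : 'I_(m./2) -> 'M[R]_2) (l : 'I_m -> R),
    (forall i, (exists a b, D i = mx2 a b (- b) a) \/
               (exists c d, D i = mx2 c 0 0 d)) /\
    M = block_diag D l].

(* Inner product of row [j] of [U] with row [k] of [V]. *)
Definition row_dot (R : realType) (m n : nat) (U : 'M[R]_(m, n)) (j : 'I_m)
    (V : 'M[R]_(m, n)) (k : 'I_m) : R :=
  (row j U *m (row k V)^T) 0 0.

(* Below, [U] and [V] stand for Q^T X and Q^T Y. *)

Definition phi (R : realType) (m n : nat) (U : 'M[R]_(m, n)) (j : 'I_m) : R :=
  frobenius (row j U) ^+ 2.

Definition gamma (R : realType) (m n : nat) (U V : 'M[R]_(m, n)) (j : 'I_m) : R :=
  row_dot V j U j.

Definition alpha (R : realType) (m n : nat) (U V : 'M[R]_(m, n))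
    (i : 'I_(m./2)) : R :=
  row_dot U (blk i 0) V (blk i 0) + row_dot U (blk i 1) V (blk i 1).

Definition beta (R : realType) (m n : nat) (U V : 'M[R]_(m, n))
    (i : 'I_(m./2)) : R :=
  row_dot U (blk i 1) V (blk i 0) - row_dot U (blk i 0) V (blk i 1).

Definition rho (R : realType) (m n : nat) (U V : 'M[R]_(m, n)) (i : 'I_(m./2))
    (D : 'M[R]_2) : R :=
  frobenius (D *m rowsub (blk i) U - rowsub (blk i) V) ^+ 2.

Definition a_star (R : realType) (m n : nat) (U V : 'M[R]_(m, n))
    (i : 'I_(m./2)) : R :=
  if phi U (blk i 0) + phi U (blk i 1) != 0
  then alpha U V i / (phi U (blk i 0) + phi U (blk i 1)) else 0.

Definition b_star (R : realType) (m n : nat) (U V : 'M[R]_(m, n))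
    (i : 'I_(m./2)) : R :=
  if phi U (blk i 0) + phi U (blk i 1) != 0
  then beta U V i / (phi U (blk i 0) + phi U (blk i 1)) else 0.

Definition lambda_star (R : realType) (m n : nat) (U V : 'M[R]_(m, n))
    (j : 'I_m) : R :=
  if row j U != 0 then gamma U V j / phi U j else 0.

Definition Psi_star (R : realType) (m n : nat) (U V : 'M[R]_(m, n))
    (i : 'I_(m./2)) : 'M[R]_2 :=
  mx2 (a_star U V i) (b_star U V i) (- b_star U V i) (a_star U V i).

Definition Omega_star (R : realType) (m n : nat) (U V : 'M[R]_(m, n))
    (i : 'I_(m./2)) : 'M[R]_2 :=
  mx2 (lambda_star U V (blk i 0)) 0 0 (lambda_star U V (blk i 1)).

Definition Delta_blk_star (R : realType) (m n : nat) (U V : 'M[R]_(m, n))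
    (i : 'I_(m./2)) : 'M[R]_2 :=
  if rho U V i (Psi_star U V i) < rho U V i (Omega_star U V i)
  then Psi_star U V i else Omega_star U V i.

Definition Delta_star (R : realType) (m n : nat) (X Y : 'M[R]_(m, n))
    (Q : 'M[R]_m) : 'M[R]_m :=
  let U := Q^T *m X in
  let V := Q^T *m Y in
  block_diag (Delta_blk_star U V) (lambda_star U V).

(* Since [x / 0 = 0], terms with a vanishing denominator are zero.  The last
   sum has exactly one term when [m] is odd, and none when [m] is even. *)
Definition g (R : realType) (m n : nat) (X Y : 'M[R]_(m, n)) (Q : 'M[R]_m) : R :=
  let U := Q^T *m X in
  let V := Q^T *m Y in
  \sum_(i < m./2)
     Num.max ((alpha U V i ^+ 2 + beta U V i ^+ 2) /
                (phi U (blk i 0) + phi U (blk i 1)))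
             (gamma U V (blk i 0) ^+ 2 / phi U (blk i 0) +
              gamma U V (blk i 1) ^+ 2 / phi U (blk i 1))
  + \sum_(j < m | odd m && (j.+1 == m :> nat)) gamma U V j ^+ 2 / phi U j.

Definition procrustes_obj (R : realType) (m n : nat) (X Y : 'M[R]_(m, n))
    (A : 'M[R]_m) : R :=
  frobenius (A *m X - Y) ^+ 2.

Definition A_star (R : realType) (m n : nat) (X Y : 'M[R]_(m, n))
    (Q : 'M[R]_m) : 'M[R]_m :=
  Q *m Delta_star X Y Q *m Q^T.

(* Main.v *)
Require Import Defs.
From mathcomp Require Import all_boot all_order all_algebra.
From mathcomp Require Import all_classical all_reals.
From mathcomp Require Import spectral complex.
From mathcomp Require Import zify ring lra.

Set Implicit Arguments.
Unset Strict Implicit.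
Unset Printing Implicit Defensive.

Import Order.TTheory GRing.Theory Num.Theory.

Local Open Scope ring_scope.
Local Open Scope classical_set_scope.

(** The real normal form of a real normal matrix is the whole bridge between the
two problems.  If A is normal then A = Q M Q^T with Q orthogonal and M block
diagonal with blocks [a b; -b a] or diag(c, d) (plus a single real entry when m
is odd), and conversely every such A is normal.  Since Q is an isometry,
||A X - Y|| = ||M U - V|| with U = Q^T X and V = Q^T Y, so minimizing over the
normal matrices is minimizing over Q and, for Q fixed, over the block diagonal M.

For Q fixed the objective is a sum of independent contributions of the blocks
(frobenius_blocks, rowsub_block_diag), and on each of the two shapes it is a
separable quadratic t^2 s - 2 t c in the free parameters t, where s is a squared
norm that forces c = 0 when it vanishes.  Its minimum is - c^2 / s, reached at
t = c / s (quad_argmin), which also gives t^2 s = c^2 / s: this one computation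
shows that Delta_Q is optimal, that ||Delta_Q U||^2 = g(Q), and that the optimal
value is ||Y||^2 - g(Q) (Delta_gain, Delta_dist, block_form_dist_ge).  Hence
||A X - Y||^2 >= ||Y||^2 - g(Q) for every Q that block diagonalizes A, with
equality for A = Q Delta_Q Q^T; every part of the equivalence follows, including
the equality of optimal values when nothing is assumed about their being reached.

The normal form itself (real_normal_form) is obtained by splitting off a plane
that A and A^T both preserve.  A and A^T commute, so they share a complex
eigenvector; its real and imaginary parts x, y span an invariant subspace, and
comparing <x A, y> with <x, y A^T> shows that x and y are orthogonal and of the
same length unless the eigenvalue is real (normal_rot_pair).  If it is
not real, they give a block [a b; -b a].  If it is real, so is some eigenvector;
the compression of A to its orthogonal complement is again normal, and a second
use of the same argument there gives either a second real eigenvector, hence a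
block diag(c, d), or a rotation block of A (normal_plane).  Splitting off two
dimensions at a time keeps the blocks aligned with the pairs of rows. *)

(** * Inner products of rows and the Frobenius norm *)

Section Dot.
Context {R : realType}.

Definition dotr n (u v : 'rV[R]_n) : R := (u *m v^T) 0 0.

Lemma dotrE n (u v : 'rV[R]_n) : dotr u v = \sum_j u 0 j * v 0 j.
Proof. by rewrite /dotr mxE; apply: eq_bigr => j _; rewrite mxE. Qed.

Lemma dotrC n (u v : 'rV[R]_n) : dotr u v = dotr v u.
Proof. by rewrite !dotrE; apply: eq_bigr => j _; rewrite mulrC. Qed.

Lemma dotrDl n (u v w : 'rV[R]_n) : dotr (u + v) w = dotr u w + dotr v w.
Proof. by rewrite /dotr mulmxDl mxE. Qed.

Lemma dotrZl n c (u w : 'rV[R]_n) : dotr (c *: u) w = c * dotr u w.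
Proof. by rewrite /dotr -scalemxAl mxE. Qed.

Lemma dotrDr n (u v w : 'rV[R]_n) : dotr w (u + v) = dotr w u + dotr w v.
Proof. by rewrite !(dotrC w) dotrDl. Qed.

Lemma dotrZr n c (u w : 'rV[R]_n) : dotr w (c *: u) = c * dotr w u.
Proof. by rewrite !(dotrC w) dotrZl. Qed.

Lemma dotrNl n (u w : 'rV[R]_n) : dotr (- u) w = - dotr u w.
Proof. by rewrite -scaleN1r dotrZl mulN1r. Qed.

Lemma dotrNr n (u w : 'rV[R]_n) : dotr w (- u) = - dotr w u.
Proof. by rewrite !(dotrC w) dotrNl. Qed.

Definition dotrLin := (dotrDl, dotrDr, dotrNl, dotrNr, dotrZl, dotrZr).

Lemma dotr_ge0 n (u : 'rV[R]_n) : 0 <= dotr u u.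
Proof. by rewrite dotrE sumr_ge0 // => j _; rewrite -expr2 sqr_ge0. Qed.

Lemma dotr_eq0 n (u : 'rV[R]_n) : (dotr u u == 0) = (u == 0).
Proof.
apply/eqP/eqP => [u0|->]; last by rewrite /dotr mul0mx mxE.
apply/rowP => j; rewrite mxE; apply/eqP; rewrite -sqrf_eq0.
move: u0; rewrite dotrE => /psumr_eq0P u0; rewrite expr2; apply/eqP/u0 => // k _.
by rewrite -expr2 sqr_ge0.
Qed.

Lemma dotr_mulmx_tr m (A : 'M[R]_m) (u v : 'rV[R]_m) :
  dotr (u *m A) v = dotr u (v *m A^T).
Proof. by rewrite /dotr trmx_mul trmxK mulmxA. Qed.

Lemma dotr0l n (u v : 'rV[R]_n) : u = 0 -> dotr u v = 0.
Proof. by move=> ->; rewrite /dotr mul0mx mxE. Qed.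

Lemma frobenius_sqr m n (A : 'M[R]_(m, n)) :
  frobenius A ^+ 2 = \sum_i dotr (row i A) (row i A).
Proof.
rewrite sqr_sqrtr; last first.
  by do 2![apply: sumr_ge0 => ? _]; rewrite sqr_ge0.
apply: eq_bigr => i _; rewrite dotrE; apply: eq_bigr => j _.
by rewrite !mxE expr2.
Qed.

Lemma frobenius_sqr_tr m n (A : 'M[R]_(m, n)) :
  frobenius A ^+ 2 = \tr (A^T *m A).
Proof.
rewrite mxtrace_mulC frobenius_sqr; apply: eq_bigr => i _.
by rewrite /dotr mxE [RHS]mxE; apply: eq_bigr => j _; rewrite !mxE.
Qed.

Lemma frobenius_isometry m n (Q : 'M[R]_m) (A : 'M[R]_(m, n)) :
  Q^T *m Q = 1%:M -> frobenius (Q *m A) ^+ 2 = frobenius A ^+ 2.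
Proof.
by move=> QQ; rewrite !frobenius_sqr_tr trmx_mul mulmxA -(mulmxA A^T) QQ mulmx1.
Qed.

Lemma phiE m n (U : 'M[R]_(m, n)) j : phi U j = dotr (row j U) (row j U).
Proof. by rewrite /phi frobenius_sqr big_ord1 row_id. Qed.

End Dot.

(** * Rows grouped in pairs, and block diagonal matrices *)

Section Blocks.
Context {R : realType}.

Lemma ord2P (P : 'I_2 -> Prop) : P 0 -> P 1 -> forall p, P p.
Proof.
move=> P0 P1 [[|[|p]] lt_p2] //.
- by congr (P _): P0; apply: val_inj.
- by congr (P _): P1; apply: val_inj.
Qed.

(** The row that belongs to no pair; the condition is the one that selects the
last term of [g]. *)
Definition lone_row m (j : 'I_m) := odd m && (j.+1 == m :> nat).

Lemma blk_half m (i : 'I_(m./2)) p : (blk i p)./2 = i.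
Proof.
rewrite [nat_of_ord _]addnC; elim/ord2P: p.
- exact: (half_bit_double i false).
- exact: (half_bit_double i true).
Qed.

Lemma blk_odd m (i : 'I_(m./2)) p : inord (odd (blk i p)) = p.
Proof.
apply: ord_inj; rewrite inordK; last by case: odd.
by rewrite /= oddD odd_double; elim/ord2P: p.
Qed.

Lemma lone_row_half m (j : 'I_m) : lone_row j = (m./2 <= j./2)%N.
Proof.
rewrite /lone_row; have := ltn_ord j.
have := odd_double_half m; have := odd_double_half j.
by case: (odd m); case: (odd j) => /=; lia.
Qed.

Lemma lone_row_inj m (j s : 'I_m) : lone_row j -> j./2 = s./2 -> j = s.
Proof.
move=> lone_j eq_h; have lone_s: lone_row s by rewrite lone_row_half -eq_h -lone_row_half.
apply: ord_inj; case/andP: lone_j => _ /eqP ej; case/andP: lone_s => _ /eqP es.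
by apply: succn_inj; rewrite ej es.
Qed.

Lemma blkK m (r : 'I_m) (lt_r : (r./2 < m./2)%N) :
  blk (Ordinal lt_r) (inord (odd r)) = r.
Proof.
apply: ord_inj; rewrite /= inordK; last by case: odd.
by rewrite addnC odd_double_half.
Qed.

Lemma rows_ind m (P : 'I_m -> Prop) :
  (forall i p, P (blk i p)) -> (forall j, lone_row j -> P j) -> forall r, P r.
Proof.
move=> Pblk Plone r; have [lone|] := boolP (lone_row r); first exact: Plone.
by rewrite lone_row_half -ltnNge => lt_r; rewrite -(blkK lt_r).
Qed.

Lemma sum_rows m (F : 'I_m -> R) :
  \sum_r F r = \sum_(i < m./2) (F (blk i 0) + F (blk i 1))
               + \sum_(j < m | lone_row j) F j.
Proof.
rewrite (bigID (@lone_row m)) /= addrC; congr (_ + _).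
transitivity (\sum_(i < m./2) \sum_(p < 2) F (blk i p)); last first.
  apply: eq_bigr => i _; rewrite big_ord_recl big_ord1.
  by congr (_ + F (blk i _)); apply: val_inj.
(* row r is row (odd r) of block r./2, if that block exists *)
pose inv_blk (r : 'I_m) :=
  omap (fun i : 'I_(m./2) => (i, inord (odd r) : 'I_2)) (insub (r./2)).
rewrite pair_big /= (reindex_omap (fun ip : 'I_(m./2) * 'I_2 => blk ip.1 ip.2) inv_blk) /=.
  apply: eq_bigl => -[i p] /=; rewrite lone_row_half blk_half -ltnNge ltn_ord /=.
  by rewrite /inv_blk blk_half blk_odd valK /= eqxx.
move=> r; rewrite lone_row_half -ltnNge => lt_r.
by rewrite /inv_blk insubT /= blkK.
Qed.

Lemma block_diagE m (D : 'I_(m./2) -> 'M[R]_2) l i p s :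
  block_diag D l (blk i p) s =
  if i == s./2 :> nat then D i p (inord (odd s)) else 0.
Proof.
rewrite mxE blk_half; case: eqP => //= _.
rewrite (insubT (fun k => k < m./2)%N (ltn_ord i)) blk_odd /=.
by congr (D _ _ _); apply: val_inj.
Qed.

Lemma block_diag_lone m (D : 'I_(m./2) -> 'M[R]_2) l j s : lone_row j ->
  block_diag D l j s = if j == s then l j else 0.
Proof.
move=> lone_j; rewrite mxE; case: (eqVneq j s) => [<-|ne_js].
  by rewrite eqxx /= insubF // ltnNge -lone_row_half lone_j.
by case: eqP => // /(lone_row_inj lone_j) /eqP; rewrite (negPf ne_js).
Qed.

(** Together with [row_block_diag], this reduces products with block diagonal
matrices to products with their blocks: it is why the objective decouples and
why normality can be checked block by block. *)
Lemma rowsub_block_diag m n (D : 'I_(m./2) -> 'M[R]_2) l (U : 'M[R]_(m, n)) i :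
  rowsub (blk i) (block_diag D l *m U) = D i *m rowsub (blk i) U.
Proof.
apply/matrixP => p k; rewrite !mxE sum_rows [X in _ + X]big1 ?addr0 => [|s]; last first.
  rewrite lone_row_half => lone_s; rewrite block_diagE ltn_eqF ?mul0r //.
  exact: leq_trans lone_s.
rewrite (bigD1 i) //= [X in _ + X]big1 ?addr0 => [|i' ne_i]; last first.
  rewrite !block_diagE !blk_half eq_sym -[_ == _ :> nat]/(i' == i) (negPf ne_i).
  by rewrite !mul0r addr0.
rewrite !block_diagE !blk_half !eqxx !blk_odd big_ord_recl big_ord1 !mxE.
by congr (_ + D i _ _ * U (blk i _) _); apply: val_inj.
Qed.

Lemma row_block_diag m n (D : 'I_(m./2) -> 'M[R]_2) l (U : 'M[R]_(m, n)) j :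
  lone_row j -> row j (block_diag D l *m U) = l j *: row j U.
Proof.
move=> lone_j; apply/rowP => k; rewrite !mxE (bigD1 j) //= big1 ?addr0 => [|s ne_s].
  by rewrite block_diag_lone // eqxx.
by rewrite block_diag_lone // eq_sym (negPf ne_s) mul0r.
Qed.

Lemma matrix_blocks m n (A B : 'M[R]_(m, n)) :
  (forall i, rowsub (blk i) A = rowsub (blk i) B) ->
  (forall j, lone_row j -> row j A = row j B) -> A = B.
Proof.
move=> eq_blk eq_lone; apply/row_matrixP; apply: rows_ind => // i p.
by have /(congr1 (row p)) := eq_blk i; rewrite !row_rowsub.
Qed.

Lemma block_diag_mul m (D D' : 'I_(m./2) -> 'M[R]_2) l l' :
  block_diag D l *m block_diag D' l' =
  block_diag (fun i => D i *m D' i) (fun j => l j * l' j).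
Proof.
rewrite -[block_diag D' _]mulmx1 -[RHS]mulmx1; apply: matrix_blocks => [i|j lone_j].
  by rewrite !rowsub_block_diag mulmxA.
by rewrite !row_block_diag // scalerA.
Qed.

Lemma block_diag_tr m (D : 'I_(m./2) -> 'M[R]_2) l :
  (block_diag D l)^T = block_diag (fun i => (D i)^T) l.
Proof.
apply/matrixP => r s; rewrite [LHS]mxE ![block_diag _ _ _ _]mxE eq_sym.
case: eqP => //= eq_h; rewrite -eq_h; case: insubP => [i _ _|]; first by rewrite mxE.
rewrite -leqNgt -lone_row_half => lone_r.
by rewrite (lone_row_inj lone_r eq_h).
Qed.

(** The decoupling of the Procrustes objective at a fixed orthogonal matrix. *)
Lemma frobenius_blocks m n (A : 'M[R]_(m, n)) :
  frobenius A ^+ 2 = \sum_(i < m./2) frobenius (rowsub (blk i) A) ^+ 2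
                     + \sum_(j < m | lone_row j) frobenius (row j A) ^+ 2.
Proof.
rewrite frobenius_sqr sum_rows; congr (_ + _); apply: eq_bigr => i _; last first.
  by rewrite -phiE.
rewrite frobenius_sqr big_ord_recl big_ord1 !row_rowsub.
by congr (_ + dotr (row (blk i _) A) (row (blk i _) A)); apply: val_inj.
Qed.

Lemma mx2E (a b c d : R) :
  ((mx2 a b c d 0 0 = a) * (mx2 a b c d 0 1 = b)) *
  ((mx2 a b c d 1 0 = c) * (mx2 a b c d 1 1 = d)).
Proof.
have e0 : 0 = @lshift 1 1 0 by apply: val_inj.
have e1 : 1 = @rshift 1 1 0 by apply: val_inj.
split; split; rewrite ?e0 ?e1.
- by rewrite [LHS](block_mxEul (a%:M : 'M_1)) mxE.
- by rewrite [LHS](block_mxEur (a%:M : 'M_1)) mxE.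
- by rewrite [LHS](block_mxEdl (a%:M : 'M_1)) mxE.
- by rewrite [LHS](block_mxEdr (a%:M : 'M_1)) mxE.
Qed.

Lemma mx2_tr (a b c d : R) : (mx2 a b c d)^T = mx2 a c b d.
Proof.
by apply/matrixP; apply: ord2P; apply: ord2P; rewrite mxE !mx2E.
Qed.

Lemma row_mx2_mul n a b c d (W : 'M[R]_(2, n)) :
  (row 0 (mx2 a b c d *m W) = a *: row 0 W + b *: row 1 W) *
  (row 1 (mx2 a b c d *m W) = c *: row 0 W + d *: row 1 W).
Proof.
have e1 : lift 0 0 = 1 :> 'I_2 by apply: val_inj.
by split; apply/rowP => k; rewrite !mxE big_ord_recl big_ord1 e1 !mx2E.
Qed.

Lemma mx2_mul (a b c d a' b' c' d' : R) :
  mx2 a b c d *m mx2 a' b' c' d' =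
  mx2 (a * a' + b * c') (a * b' + b * d') (c * a' + d * c') (c * b' + d * d').
Proof.
have e1 : lift 0 0 = 1 :> 'I_2 by apply: val_inj.
by apply/matrixP; apply: ord2P; apply: ord2P;
   rewrite mx2E mxE big_ord_recl big_ord1 e1 !mx2E.
Qed.

End Blocks.

(** * Optimal blocks for a fixed orthogonal matrix *)

Section BlockOptimum.
Context {R : realType}.

(** Completing the square; with inverses of 0 equal to 0, the bound also holds,
as an equality, in the degenerate case s = c = 0. *)
Lemma quad_argmin (s c t : R) : 0 <= s -> (s = 0 -> c = 0) ->
  - (c ^+ 2 / s) <= t ^+ 2 * s - 2 * (t * c).
Proof.
move=> s_ge0 c0; have [s0|s_neq0] := eqVneq s 0.
  by rewrite s0 c0 // invr0; lra.
have s_gt0 : 0 < s by rewrite lt_def s_neq0.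
rewrite -subr_ge0 (_ : _ - _ = (t * s - c) ^+ 2 / s); last by field.
by rewrite divr_ge0 ?sqr_ge0.
Qed.

Lemma quad_min_sqr (s c : R) : (c / s) ^+ 2 * s = c ^+ 2 / s.
Proof.
have [->|s_neq0] := eqVneq s 0; last by field.
by rewrite invr0; ring.
Qed.

Lemma quad_min_cross (s c : R) : c / s * c = c ^+ 2 / s.
Proof. by rewrite mulrAC. Qed.

Variables (m n : nat) (U V : 'M[R]_(m, n)).

Lemma frobenius2 (W : 'M[R]_(2, n)) :
  frobenius W ^+ 2 = dotr (row 0 W) (row 0 W) + dotr (row 1 W) (row 1 W).
Proof.
have e1 : lift 0 0 = 1 :> 'I_2 by apply: val_inj.
by rewrite frobenius_sqr big_ord_recl big_ord1 e1.
Qed.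

Lemma frobenius_rot i a b :
  frobenius (mx2 a b (- b) a *m rowsub (blk i) U) ^+ 2 =
  (a ^+ 2 + b ^+ 2) * (phi U (blk i 0) + phi U (blk i 1)).
Proof.
rewrite frobenius2 !row_mx2_mul !row_rowsub !dotrLin !phiE.
rewrite (dotrC (row (blk i 1) U) (row (blk i 0) U)); ring.
Qed.

Lemma rho_rot i a b :
  rho U V i (mx2 a b (- b) a) =
  frobenius (rowsub (blk i) V) ^+ 2
  + (a ^+ 2 + b ^+ 2) * (phi U (blk i 0) + phi U (blk i 1))
  - 2 * (a * alpha U V i + b * beta U V i).
Proof.
rewrite -frobenius_rot /rho !frobenius2 !linearB /= !row_mx2_mul !row_rowsub.
rewrite /alpha /beta /row_dot -!/(dotr _ _) !dotrLin.
rewrite !(dotrC (row _ V) (row _ U)); ring.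
Qed.

Lemma frobenius_diag i c d :
  frobenius (mx2 c 0 0 d *m rowsub (blk i) U) ^+ 2 =
  c ^+ 2 * phi U (blk i 0) + d ^+ 2 * phi U (blk i 1).
Proof.
by rewrite frobenius2 !row_mx2_mul !row_rowsub !dotrLin !phiE; ring.
Qed.

Lemma rho_diag i c d :
  rho U V i (mx2 c 0 0 d) =
  frobenius (rowsub (blk i) V) ^+ 2
  + (c ^+ 2 * phi U (blk i 0) - 2 * (c * gamma U V (blk i 0)))
  + (d ^+ 2 * phi U (blk i 1) - 2 * (d * gamma U V (blk i 1))).
Proof.
rewrite /rho !frobenius2 !linearB /= !row_mx2_mul !row_rowsub.
rewrite /gamma /row_dot -!/(dotr _ _) !phiE !dotrLin.
rewrite !(dotrC (row _ V) (row _ U)); ring.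
Qed.

Lemma row_scale_dist j t :
  frobenius (t *: row j U - row j V) ^+ 2 =
  frobenius (row j V) ^+ 2 + (t ^+ 2 * phi U j - 2 * (t * gamma U V j)).
Proof.
rewrite !frobenius_sqr !big_ord1 !row_id phiE /gamma /row_dot -/(dotr _ _) !dotrLin.
by rewrite !(dotrC (row _ V) (row _ U)); ring.
Qed.

Lemma phi_ge0 j : 0 <= phi U j.
Proof. by rewrite phiE dotr_ge0. Qed.

Lemma phi_eq0 j : phi U j = 0 -> row j U = 0.
Proof. by rewrite phiE => /eqP; rewrite dotr_eq0 => /eqP. Qed.

Lemma gamma_eq0 j : phi U j = 0 -> gamma U V j = 0.
Proof.
by move=> /phi_eq0 U0; rewrite /gamma /row_dot -/(dotr _ _) dotrC dotr0l.
Qed.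

Lemma alpha_beta_eq0 i : phi U (blk i 0) + phi U (blk i 1) = 0 ->
  alpha U V i = 0 /\ beta U V i = 0.
Proof.
move=> /eqP; rewrite paddr_eq0 ?phi_ge0 // => /andP[/eqP/phi_eq0 U0 /eqP/phi_eq0 U1].
by rewrite /alpha /beta /row_dot -!/(dotr _ _) !dotr0l // addr0 subr0.
Qed.

Lemma a_starE i : a_star U V i = alpha U V i / (phi U (blk i 0) + phi U (blk i 1)).
Proof. by rewrite /a_star; case: eqP => //= ->; rewrite invr0 mulr0. Qed.

Lemma b_starE i : b_star U V i = beta U V i / (phi U (blk i 0) + phi U (blk i 1)).
Proof. by rewrite /b_star; case: eqP => //= ->; rewrite invr0 mulr0. Qed.

Lemma lambda_starE j : lambda_star U V j = gamma U V j / phi U j.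
Proof.
rewrite /lambda_star; case: eqP => //= U0.
by rewrite /gamma /row_dot -/(dotr _ _) dotrC dotr0l ?mul0r.
Qed.

(** How much the best block of each shape lowers [rho] below the value that it
has at the zero block: the two terms between which [g] takes a maximum. *)
Definition rot_gain i :=
  (alpha U V i ^+ 2 + beta U V i ^+ 2) / (phi U (blk i 0) + phi U (blk i 1)).

Definition diag_gain i :=
  gamma U V (blk i 0) ^+ 2 / phi U (blk i 0) +
  gamma U V (blk i 1) ^+ 2 / phi U (blk i 1).

Lemma Psi_star_gain i :
  frobenius (Psi_star U V i *m rowsub (blk i) U) ^+ 2 = rot_gain i /\
  rho U V i (Psi_star U V i) = frobenius (rowsub (blk i) V) ^+ 2 - rot_gain i.
Proof.
rewrite /Psi_star rho_rot frobenius_rot mulrDl a_starE b_starE.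
rewrite !quad_min_sqr !quad_min_cross /rot_gain mulrDl; split; ring.
Qed.

Lemma Omega_star_gain i :
  frobenius (Omega_star U V i *m rowsub (blk i) U) ^+ 2 = diag_gain i /\
  rho U V i (Omega_star U V i) = frobenius (rowsub (blk i) V) ^+ 2 - diag_gain i.
Proof.
rewrite /Omega_star rho_diag frobenius_diag !lambda_starE.
rewrite !quad_min_sqr !quad_min_cross /diag_gain; split; ring.
Qed.

(** The shape with the smaller residual is the one with the larger gain, so the
choice made in [Delta_blk_star] realizes the maximum. *)
Lemma Delta_blk_star_gain i (gain := Num.max (rot_gain i) (diag_gain i)) :
  frobenius (Delta_blk_star U V i *m rowsub (blk i) U) ^+ 2 = gain /\
  rho U V i (Delta_blk_star U V i) = frobenius (rowsub (blk i) V) ^+ 2 - gain.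
Proof.
have [Psi1 Psi2] := Psi_star_gain i; have [Om1 Om2] := Omega_star_gain i.
rewrite /Delta_blk_star {}/gain Psi2 Om2 ltrD2l ltrN2.
by case: ltP => [/ltW|] h; rewrite ?Psi1 ?Om1 ?Psi2 ?Om2; split.
Qed.

Lemma rho_ge i D :
  (exists a b, D = mx2 a b (- b) a) \/ (exists c d, D = mx2 c 0 0 d) ->
  frobenius (rowsub (blk i) V) ^+ 2 - Num.max (rot_gain i) (diag_gain i)
    <= rho U V i D.
Proof.
have phi0 := phi_ge0 (blk i 0); have phi1 := phi_ge0 (blk i 1).
case=> [[a [b ->]]|[c [d ->]]].
  apply: (@le_trans _ _ (frobenius (rowsub (blk i) V) ^+ 2 - rot_gain i)).
    by rewrite lerD2l lerN2 le_max lexx.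
  have qa := quad_argmin a (addr_ge0 phi0 phi1) (fun h => (alpha_beta_eq0 h).1).
  have qb := quad_argmin b (addr_ge0 phi0 phi1) (fun h => (alpha_beta_eq0 h).2).
  move: qa qb.
  by rewrite rho_rot /rot_gain !mulrDl; lra.
apply: (@le_trans _ _ (frobenius (rowsub (blk i) V) ^+ 2 - diag_gain i)).
  by rewrite lerD2l lerN2 le_max lexx orbT.
have := quad_argmin c phi0 (@gamma_eq0 (blk i 0)).
have := quad_argmin d phi1 (@gamma_eq0 (blk i 1)).
by rewrite rho_diag /diag_gain; lra.
Qed.

End BlockOptimum.

Section FixedQ.
Context {R : realType}.
Variables (m n : nat) (U V : 'M[R]_(m, n)).

(** The value of [g], as a function of U = Q^T X and V = Q^T Y. *)
Definition gain := \sum_(i < m./2) Num.max (rot_gain U V i) (diag_gain U V i)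
  + \sum_(j < m | lone_row j) gamma U V j ^+ 2 / phi U j.

Local Notation Delta := (block_diag (Delta_blk_star U V) (lambda_star U V)).

Lemma Delta_blk_star_form i :
  (exists a b, Delta_blk_star U V i = mx2 a b (- b) a) \/
  (exists c d, Delta_blk_star U V i = mx2 c 0 0 d).
Proof.
rewrite /Delta_blk_star; case: ifP => _; [left|right].
  by exists (a_star U V i), (b_star U V i).
by exists (lambda_star U V (blk i 0)), (lambda_star U V (blk i 1)).
Qed.

Lemma Delta_form : normal_block_form Delta.
Proof.
by exists (Delta_blk_star U V), (lambda_star U V); split=> //; exact: Delta_blk_star_form.
Qed.

Lemma block_dist D l :
  frobenius (block_diag D l *m U - V) ^+ 2 =
  \sum_i rho U V i (D i)
  + \sum_(j | lone_row j) frobenius (l j *: row j U - row j V) ^+ 2.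
Proof.
rewrite frobenius_blocks; congr (_ + _); [apply: eq_bigr => i _|apply: eq_bigr => j lone_j].
  rewrite /rho -(rowsub_block_diag D l); congr (frobenius _ ^+ 2).
  by apply/matrixP=> p k; rewrite !mxE.
by rewrite linearB /= row_block_diag.
Qed.

Lemma Delta_gain : frobenius (Delta *m U) ^+ 2 = gain.
Proof.
rewrite frobenius_blocks; congr (_ + _); [apply: eq_bigr => i _|apply: eq_bigr => j lone_j].
  by rewrite rowsub_block_diag (Delta_blk_star_gain U V i).1.
rewrite row_block_diag // lambda_starE -quad_min_sqr frobenius_sqr big_ord1 row_id phiE.
by rewrite !dotrLin expr2 mulrA.
Qed.

Lemma Delta_dist : frobenius (Delta *m U - V) ^+ 2 = frobenius V ^+ 2 - gain.
Proof.
rewrite block_dist (frobenius_blocks V) /gain opprD addrACA -!sumrB.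
congr (_ + _); [apply: eq_bigr => i _|apply: eq_bigr => j _].
  by rewrite (Delta_blk_star_gain U V i).2.
by rewrite row_scale_dist lambda_starE quad_min_sqr quad_min_cross; ring.
Qed.

Lemma block_form_dist_ge M : normal_block_form M ->
  frobenius V ^+ 2 - gain <= frobenius (M *m U - V) ^+ 2.
Proof.
case=> D [l [formD ->]].
rewrite block_dist (frobenius_blocks V) /gain opprD addrACA -!sumrB.
apply: lerD; [apply: ler_sum => i _|apply: ler_sum => j _].
  exact: rho_ge.
rewrite row_scale_dist lerD2l.
exact: quad_argmin (phi_ge0 U j) (@gamma_eq0 _ _ _ U V j).
Qed.

End FixedQ.

Lemma normal_block_form_normal (R : realType) m (M : 'M[R]_m) :
  normal_block_form M -> normal_mx M.
Proof.
case=> D [l [formD ->]]; rewrite /normal_mx /= block_diag_tr !block_diag_mul.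
congr block_diag; apply/funext => i.
by case: (formD i) => [[a [b ->]]|[c [d ->]]]; rewrite mx2_tr !mx2_mul; congr mx2; ring.
Qed.

(** * Common eigenvectors of a real normal matrix and its transpose *)

Section Complexify.
Context {R : realType}.
Local Notation toC := (real_complex R).

Lemma complex_eigen_split m (A : 'M[R]_m) (v : 'rV[R[i]%C]_m) (l : R[i]%C)
    (x := map_mx (@complex.Re R) v) (y := map_mx (@complex.Im R) v) :
  v *m map_mx toC A = l *: v ->
  x *m A = complex.Re l *: x - complex.Im l *: y /\
  y *m A = complex.Im l *: x + complex.Re l *: y.
Proof.
move=> eig; split; apply/rowP => j; move/rowP/(_ j): eig; rewrite !mxE.
  move/(congr1 (@complex.Re R)); rewrite raddf_sum /= => eig.
  transitivity (complex.Re (l * v 0 j)); last by case: l (v 0 j) {eig} => ? ? [].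
  rewrite -eig; apply: eq_bigr => k _; rewrite !mxE /=.
  by case: (v 0 k) => ? ? /=; rewrite mulr0 subr0.
move/(congr1 (@complex.Im R)); rewrite raddf_sum /= => eig.
transitivity (complex.Im (l * v 0 j)); last first.
  by case: l (v 0 j) {eig} => ? ? [] ? ? /=; rewrite addrC.
rewrite -eig; apply: eq_bigr => k _; rewrite !mxE /=.
by case: (v 0 k) => ? ? /=; rewrite mulr0 add0r.
Qed.

(** The real form of a complex eigenvector x + i y shared by A and A^T.  The
vectors x and y may be dependent, and one of them may vanish; unless both do,
this forces b = 0. *)
Definition rot_pair m (A : 'M[R]_m) a b (x y : 'rV[R]_m) : Prop :=
  [/\ x *m A = a *: x + b *: y, y *m A = - b *: x + a *: y,
      x *m A^T = a *: x - b *: y & y *m A^T = b *: x + a *: y].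

(** x and y are the real and imaginary parts of a common complex eigenvector of
A and A^T.  The four identities between <x A, y> and <x, y A^T>, and likewise for
the other pairs, force the two eigenvalues to be conjugate, and they force
|x| = |y| and <x, y> = 0 as soon as the eigenvalue is not real. *)
Lemma normal_rot_pair m (A : 'M[R]_m) : (0 < m)%N -> normal_mx A ->
  exists a b x y, [/\ rot_pair A a b x y, ~~ ((x == 0) && (y == 0)) &
    b != 0 -> dotr x x = dotr y y /\ dotr x y = 0].
Proof.
move=> m_gt0; rewrite /normal_mx /= => normA.
have [|v v_neq0 /andP[]] :=
  @common_eigenvector2 R[i]%C m (map_mx toC A) (map_mx toC A^T) m_gt0.
  by rewrite -!map_mxM normA.
move=> /sub_rVP[l /complex_eigen_split[]] + + /sub_rVP[l' /complex_eigen_split[]].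
set x := map_mx _ v; set y := map_mx _ v; set a := complex.Re l; set b := complex.Im l.
set c := complex.Re l'; set d := complex.Im l' => xA yA xAt yAt.
have xy_neq0 : ~~ ((x == 0) && (y == 0)).
  apply: contraNN v_neq0 => /andP[/eqP x0 /eqP y0]; apply/eqP/rowP => j.
  move/rowP/(_ j): x0; move/rowP/(_ j): y0; rewrite !mxE.
  by case: (v 0 j) => p q /= -> ->.
have pq_gt0 : 0 < dotr x x + dotr y y.
  rewrite lt_def addr_ge0 ?dotr_ge0 // andbT paddr_eq0 ?dotr_ge0 //.
  by rewrite !dotr_eq0.
have exx := dotr_mulmx_tr A x x; have exy := dotr_mulmx_tr A x y.
have eyx := dotr_mulmx_tr A y x; have eyy := dotr_mulmx_tr A y y.
rewrite xA xAt !dotrLin in exx; rewrite xA yAt !dotrLin in exy.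
rewrite yA xAt !dotrLin in eyx; rewrite yA yAt !dotrLin in eyy.
rewrite (dotrC y x) in exx exy eyx eyy.
have ca : c = a.
  apply: (mulIf (lt0r_neq0 pq_gt0)); lra.
have db : d = - b.
  apply: (mulIf (lt0r_neq0 pq_gt0)); rewrite ca in exx exy eyx eyy; lra.
(* for rows, v A = (a + i b) v reads x A = a x - b y, hence the sign *)
exists a, (- b), x, y; split=> //.
  split; rewrite ?opprK ?scaleNr ?xA ?yA ?xAt ?yAt ?ca ?db ?scaleNr ?opprK //.
rewrite ca db oppr_eq0 in exx exy eyx eyy * => b_neq0.
by split; apply: (mulfI b_neq0); lra.
Qed.

End Complexify.

(** * Completing an orthonormal family *)

Section Completion.
Context {R : realType}.

(** As long as k < m, B^T has a nontrivial left kernel, which provides a unit row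
orthogonal to those of B.  Such rows are added until the matrix is square, where
B B^T = 1 gives B^T B = 1.  Keeping m as a variable tied to k and p by an equation avoids casts
between the types of matrices in the induction. *)
Lemma orthonormal_completion p : forall k m (B : 'M[R]_(k, m)),
  (k + p = m)%N -> B *m B^T = 1%:M ->
  exists C : 'M[R]_(p, m),
    [/\ C *m C^T = 1%:M, B *m C^T = 0 & B^T *m B + C^T *m C = 1%:M].
Proof.
elim: p => [|p IHp] k m B.
  rewrite addn0 => eq_km; case: m / eq_km B => B BB; exists 0.
  by rewrite !(trmx0, mul0mx, mulmx0, addr0) (mulmx1C BB); split=> //; apply/matrixP=> -[].
move=> eq_m BB.
have [w [w_neq0 wB]] : exists w : 'rV[R]_m, w != 0 /\ w *m B^T = 0.
  have : kermx B^T != 0.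
    rewrite kermx_eq0 /row_free; apply: contraTneq (rank_leq_col B^T) => ->.
    by rewrite -ltnNge; lia.
  by case/rowV0Pn => w /sub_kermxP wB w0; exists w.
pose u := (Num.sqrt (dotr w w))^-1 *: w.
have uu : u *m u^T = 1%:M.
  have w_gt0 : 0 < dotr w w by rewrite lt_def dotr_ge0 dotr_eq0 w_neq0.
  apply/rowP => i; rewrite ord1 -[LHS]/(dotr u u) !(dotrZl, dotrZr) !mxE /=.
  by rewrite mulrA -expr2 exprVn sqr_sqrtr ?ltW // mulVf ?gt_eqF.
have uB : u *m B^T = 0 by rewrite -scalemxAl wB scaler0.
have Bu : B *m u^T = 0 by rewrite -[LHS]trmxK trmx_mul trmxK uB trmx0.
have gram : col_mx B u *m (col_mx B u)^T = 1%:M.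
  by rewrite tr_col_mx mul_col_row BB uu uB Bu -scalar_mx_block.
have eq_m' : (k + 1 + p = m)%N by rewrite -eq_m; lia.
have [C [CC BC sumBC]] := IHp (k + 1)%N m (col_mx B u) eq_m' gram.
move: BC; rewrite mul_col_mx -[X in _ = X]vsubmxK => /eq_col_mx[].
rewrite linear0 linear0 => BC uC.
have Cu : C *m u^T = 0 by rewrite -[LHS]trmxK trmx_mul trmxK uC trmx0.
have orthC : col_mx u C *m (col_mx u C)^T = 1%:M.
  by rewrite tr_col_mx mul_col_row CC uu uC Cu -scalar_mx_block.
have orthBC : B *m (col_mx u C)^T = 0 by rewrite tr_col_mx mul_mx_row Bu BC row_mx0.
have sumB : B^T *m B + (col_mx u C)^T *m col_mx u C = 1%:M.
  by rewrite -sumBC !tr_col_mx !mul_row_col addrA.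
by exists (col_mx u C).
Qed.

End Completion.

(** * The real normal form *)

Section RealNormalForm.
Context {R : realType}.

(** When A and A^T both preserve the span of the rows of B, they also preserve
its orthogonal complement, spanned by the rows of C, so that passing to the
compression C A C^T loses nothing there. *)
Lemma normal_compression k p m (A : 'M[R]_m) (B : 'M[R]_(k, m)) (C : 'M[R]_(p, m)) D E
    (A' := C *m A *m C^T) :
  normal_mx A -> B *m A = D *m B -> B *m A^T = E *m B -> B *m C^T = 0 ->
  B^T *m B + C^T *m C = 1%:M ->
  [/\ C *m A = A' *m C, C *m A^T = A'^T *m C & normal_mx A'].
Proof.
rewrite /normal_mx /= => normA BA BAt BC sumBC.
have CAB : C *m A *m B^T = 0.
  by apply: trmx_inj; rewrite !trmx_mul trmxK mulmxA BAt -mulmxA BC mulmx0 trmx0.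
have CAtB : C *m A^T *m B^T = 0.
  by apply: trmx_inj; rewrite !trmx_mul !trmxK mulmxA BA -mulmxA BC mulmx0 trmx0.
have At' : A'^T = C *m A^T *m C^T by rewrite !trmx_mul trmxK mulmxA.
have CA : C *m A = A' *m C.
  by rewrite -[LHS]mulmx1 -sumBC mulmxDr !mulmxA CAB mul0mx add0r.
have CAt : C *m A^T = A'^T *m C.
  by rewrite -[LHS]mulmx1 -sumBC mulmxDr !mulmxA CAtB mul0mx add0r At'.
split=> //; rewrite {2}/A' {2}At' !mulmxA -CA -CAt.
by rewrite -(mulmxA C A^T A) normA mulmxA.
Qed.

(** The rows of B are, up to scaling, the real and imaginary parts of a common
eigenvector of A and A^T with an eigenvalue that is not real, if one turns up for
A or for its compression to the complement of a real eigenvector; otherwise they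
are two real eigenvectors, found one after the other. *)
Lemma normal_plane m (A : 'M[R]_m.+2) : normal_mx A ->
  exists (B : 'M[R]_(2, m.+2)) D,
    [/\ (exists a b, D = mx2 a b (- b) a) \/ (exists c d, D = mx2 c 0 0 d),
        B *m B^T = 1%:M, B *m A = D *m B & B *m A^T = D^T *m B].
Proof.
move=> normA.
have unit_row k (x : 'rV[R]_k) :
    x != 0 -> exists2 s, s != 0 & dotr (s *: x) (s *: x) = 1.
  move=> x_neq0; have x_gt0 : 0 < dotr x x by rewrite lt_def dotr_ge0 dotr_eq0 x_neq0.
  exists (Num.sqrt (dotr x x))^-1; first by rewrite invr_eq0 sqrtr_eq0 -ltNge.
  by rewrite !dotrLin mulrA -expr2 exprVn sqr_sqrtr ?ltW // mulVf ?gt_eqF.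
have two_rows (x y : 'rV[R]_m.+2) a b c d :
    [/\ dotr x x = 1, dotr y y = 1 & dotr x y = 0] ->
    [/\ x *m A = a *: x + b *: y, y *m A = c *: x + d *: y,
      x *m A^T = a *: x + c *: y & y *m A^T = b *: x + d *: y] ->
    let B : 'M[R]_(2, m.+2) := col_mx x y in
    [/\ B *m B^T = 1%:M, B *m A = mx2 a b c d *m B &
        B *m A^T = (mx2 a b c d)^T *m B].
  move=> [xx yy xy] [xA yA xAt yAt] B.
  have rowB : (row 0 B = x) * (row 1 B = y).
    have e0 : 0 = @lshift 1 1 0 by apply: val_inj.
    have e1 : 1 = @rshift 1 1 0 by apply: val_inj.
    by split; rewrite ?e0 ?e1 [LHS](@rowKu R 1 1 m.+2, @rowKd R 1 1 m.+2) row_id.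
  split.
  - rewrite [LHS](_ : _ = \matrix_(i, j) dotr (row i B) (row j B)).
      apply/matrixP; apply: ord2P; apply: ord2P;
      by rewrite [LHS]mxE [RHS]mxE !rowB ?(dotrC y x) ?xx ?yy ?xy.
    apply/matrixP => i j; rewrite [RHS]mxE dotrE !mxE.
    by apply: eq_bigr => k _; rewrite !mxE.
  - by apply/row_matrixP; apply: ord2P; rewrite row_mx2_mul row_mul !rowB.
  - by apply/row_matrixP; apply: ord2P; rewrite mx2_tr row_mx2_mul row_mul !rowB.
have rot_plane a b x y : rot_pair A a b x y -> ~~ ((x == 0) && (y == 0)) ->
    dotr x x = dotr y y /\ dotr x y = 0 ->
    exists (B : 'M[R]_(2, m.+2)) D,
    [/\ (exists a b, D = mx2 a b (- b) a) \/ (exists c d, D = mx2 c 0 0 d),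
        B *m B^T = 1%:M, B *m A = D *m B & B *m A^T = D^T *m B].
  move=> [xA yA xAt yAt] xy_neq0 [xx_yy xy].
  have x_neq0 : x != 0.
    by apply: contraNneq xy_neq0 => x0; rewrite -(dotr_eq0 y) -xx_yy x0 dotr_eq0 !eqxx.
  have [s s_neq0 xx1] := unit_row _ _ x_neq0.
  have yy1 : dotr (s *: y) (s *: y) = 1 by rewrite -xx1 !dotrLin xx_yy.
  have xy0 : dotr (s *: x) (s *: y) = 0 by rewrite !dotrLin xy !mulr0.
  have [|gramB BA BAt] := two_rows (s *: x) (s *: y) a b (- b) a (And3 xx1 yy1 xy0).
    rewrite -!scalemxAl xA yA xAt yAt !scalerDr !scalerN !scalerA ![_ * s]mulrC.
    by split; rewrite // ?mulrN ?mulNr ?scaleNr.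
  by exists (col_mx (s *: x) (s *: y)), (mx2 a b (- b) a); split=> //; left; exists a, b.
have real_row k (M : 'M[R]_k) a x y :
    rot_pair M a 0 x y -> ~~ ((x == 0) && (y == 0)) ->
    exists u, [/\ dotr u u = 1, u *m M = a *: u & u *m M^T = a *: u].
  rewrite /rot_pair oppr0 !scale0r !addr0 !add0r subr0 => -[xM yM xMt yMt].
  rewrite negb_and => /orP[] /unit_row[s _ ss].
    by exists (s *: x); rewrite -!scalemxAl xM xMt !scalerA mulrC.
  by exists (s *: y); rewrite -!scalemxAl yM yMt !scalerA mulrC.
have [a [b [x [y [rotxy xy_neq0 dots]]]]] := normal_rot_pair (ltn0Sn _) normA.
have [b0|b_neq0] := eqVneq b 0; last exact: rot_plane rotxy xy_neq0 (dots b_neq0).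
(* The eigenvalue is real: a second pair is looked for in the orthogonal
   complement of the real eigenvector u. *)
rewrite b0 in rotxy; have {x y b b0 rotxy xy_neq0 dots} [u [uu uA uAt]] :=
  real_row _ _ _ _ _ rotxy xy_neq0.
have uu1 : u *m u^T = 1%:M.
  by apply/rowP => i; rewrite ord1 -[LHS]/(dotr u u) uu mxE.
have [C [CC uC sumuC]] := @orthonormal_completion R m.+1 1 m.+2 u erefl uu1.
rewrite -mul_scalar_mx in uA; rewrite -mul_scalar_mx in uAt.
have [CA CAt normA'] := normal_compression normA uA uAt uC sumuC.
rewrite !mul_scalar_mx in uA uAt.
have lift_dot v w : dotr (v *m C) (w *m C) = dotr v w.
  by rewrite /dotr trmx_mul mulmxA -(mulmxA v) CC mulmx1.
have lift_neq0 (v : 'rV[R]_m.+1) : (v *m C == 0) = (v == 0).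
  by rewrite -[LHS]dotr_eq0 lift_dot dotr_eq0.
have [c [d [x [y [[xA yA xAt yAt] xy_neq0 dots]]]]] := normal_rot_pair (ltn0Sn _) normA'.
(* v |-> v C embeds the complement isometrically and intertwines C A C^T and A *)
have rotC : rot_pair A c d (x *m C) (y *m C).
  have dist p q : (p *: x + q *: y) *m C = p *: (x *m C) + q *: (y *m C).
    by rewrite mulmxDl -!scalemxAl.
  split; rewrite -mulmxA; first by rewrite CA mulmxA xA dist.
  - by rewrite CA mulmxA yA dist.
  - by rewrite CAt mulmxA xAt mulmxBl -!scalemxAl.
  - by rewrite CAt mulmxA yAt dist.
have xyC_neq0 : ~~ ((x *m C == 0) && (y *m C == 0)) by rewrite !lift_neq0.
have [d0|d_neq0] := eqVneq d 0; last first.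
  by apply: rot_plane rotC xyC_neq0 _; rewrite !lift_dot; exact: dots.
rewrite d0 in xA yA xAt yAt.
have [w [ww wA wAt]] := real_row _ _ _ _ _ (And4 xA yA xAt yAt) xy_neq0.
have uw : dotr u (w *m C) = 0 by rewrite /dotr trmx_mul mulmxA uC mul0mx mxE.
have ww1 : dotr (w *m C) (w *m C) = 1 by rewrite lift_dot.
have [|gramB BA BAt] := two_rows u (w *m C) a 0 0 c (And3 uu ww1 uw).
  rewrite !scale0r !addr0 !add0r uA uAt.
  split=> //; first by rewrite -mulmxA CA mulmxA wA -scalemxAl.
  by rewrite -mulmxA CAt mulmxA wAt -scalemxAl.
by exists (col_mx u (w *m C)), (mx2 a 0 0 c); split=> //; right; exists a, c.
Qed.

Lemma block_diag_cons m (D0 : 'M[R]_2) (D : 'I_(m./2) -> 'M[R]_2) (l : 'I_m -> R) :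
  block_mx D0 0 0 (block_diag D l) =
  block_diag (m := m.+2) (fun i => if unlift ord0 i is Some j then D j else D0)
    (fun r => if fintype.split (r : 'I_(2 + m)) is inr r' then l r' else 0).
Proof.
have half_shift (q : 'I_m) : (rshift 2 q)./2 = (q./2).+1 by [].
have half_lshift (p : 'I_2) : (lshift m p)./2 = 0%N by elim/ord2P: p.
apply/matrixP => r s; rewrite [RHS]mxE -(splitK r) -(splitK s).
case: (fintype.split r) => {}r; case: (fintype.split s) => {}s; rewrite !unsplitK.
- rewrite [LHS]block_mxEul; cbn [unsplit]; rewrite !half_lshift /=.
  rewrite insubT /= (_ : Sub _ _ = ord0) ?unlift_none; last exact: val_inj.
  have odd_ord2 (p : 'I_2) : inord (odd p) = p.
    by apply: ord_inj; rewrite inordK; elim/ord2P: p.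
  by rewrite !odd_ord2.
- by rewrite [LHS]block_mxEur; cbn [unsplit]; rewrite half_lshift half_shift /= mxE.
- by rewrite [LHS]block_mxEdl; cbn [unsplit]; rewrite half_lshift half_shift /= mxE.
- rewrite [LHS]block_mxEdr; cbn [unsplit]; rewrite !half_shift /= [LHS]mxE eqSS !negbK.
  case: eqP => //= _; have [lt_r|ge_r] := ltnP r./2 m./2.
    rewrite !insubT /= (_ : Sub r./2.+1 _ = lift ord0 (Sub r./2 lt_r)) ?liftK //.
    exact: val_inj.
  by rewrite !insubF // ltnNge ?ltnS ge_r.
Qed.

(** Going down by two dimensions at each step keeps the blocks of the
compression aligned with pairs of rows once the new block is put before them. *)
Lemma real_normal_form m (A : 'M[R]_m) : normal_mx A ->
  exists2 Q, orthogonal_mx Q & normal_block_form (Q^T *m A *m Q).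
Proof.
have [k] := ubnP m; elim: k m A => // k IHk [|[|m]] A lt_m normA.
- exists 1%:M; first by split; apply/matrixP => -[].
  by exists (fun=> 0), (fun=> 0); split; [case|apply/matrixP => -[]].
- exists 1%:M; first by rewrite /orthogonal_mx /= trmx1 mulmx1.
  exists (fun=> 0), (fun=> A 0 0); split; first by case.
  by apply/matrixP => i j; rewrite trmx1 mulmx1 mul1mx !ord1 mxE /= insubF.
have [B [D [formD gramB BA BAt]]] := normal_plane normA.
have [C [CC BC sumBC]] := @orthonormal_completion R m 2 m.+2 B erefl gramB.
have [CA CAt normA'] := normal_compression normA BA BAt BC sumBC.
have [//|Q [QtQ QQt] [D' [l [formD' QAQ]]]] := IHk m _ _ normA'.
  exact: (@ltnW m.+1 k lt_m).
have CB : C *m B^T = 0 by apply: trmx_inj; rewrite trmx_mul trmxK BC trmx0.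
pose P : 'M[R]_(2 + m) := col_mx B (Q^T *m C).
have PPt : P *m P^T = 1%:M.
  rewrite tr_col_mx mul_col_row gramB trmx_mul trmxK -!mulmxA (mulmxA C) CC mul1mx QtQ.
  by rewrite (mulmxA B) BC mul0mx CB mulmx0 -scalar_mx_block.
have PAP : P *m (A : 'M_(2 + m)) *m P^T = block_mx D 0 0 (block_diag D' l).
  rewrite mul_col_mx tr_col_mx mul_col_row BA -QAQ trmx_mul trmxK; congr block_mx.
  - by rewrite -mulmxA gramB mulmx1.
  - by rewrite mulmxA -(mulmxA D) BC mulmx0 mul0mx.
  - by rewrite -(mulmxA Q^T) CA -!mulmxA CB !mulmx0.
  - by rewrite !mulmxA.
exists P^T; first by split; rewrite trmxK // mulmx1C.
rewrite trmxK [P *m A *m P^T]PAP block_diag_cons; eexists; eexists; split; last reflexivity.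
by move=> i /=; case: (unliftP ord0 i) => [j _|_]; [exact: formD'|exact: formD].
Qed.

End RealNormalForm.

(** * Equivalence of the two problems *)

Section Procrustes.
Context {R : realType}.
Variables (m n : nat) (X Y : 'M[R]_(m, n)).

Lemma procrustes_obj_conj (Q M : 'M[R]_m) : orthogonal_mx Q ->
  procrustes_obj X Y (Q *m M *m Q^T) =
  frobenius (M *m (Q^T *m X) - Q^T *m Y) ^+ 2.
Proof.
move=> [QtQ QQt]; rewrite -[RHS](frobenius_isometry _ QtQ) /procrustes_obj.
by rewrite mulmxBr !mulmxA QQt mul1mx.
Qed.

Lemma procrustes_obj_A_star Q : orthogonal_mx Q ->
  procrustes_obj X Y (A_star X Y Q) = frobenius Y ^+ 2 - g X Y Q.
Proof.
move=> orthQ; rewrite /A_star procrustes_obj_conj // Delta_dist.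
by rewrite frobenius_isometry // trmxK; case: orthQ.
Qed.

(** The lower bound depends on A only through an orthogonal matrix that brings
it to block diagonal form, and by [procrustes_obj_A_star] it is reached. *)
Lemma procrustes_obj_ge Q A : orthogonal_mx Q -> normal_block_form (Q^T *m A *m Q) ->
  frobenius Y ^+ 2 - g X Y Q <= procrustes_obj X Y A.
Proof.
move=> orthQ formA; have [QtQ QQt] := orthQ.
have -> : A = Q *m (Q^T *m A *m Q) *m Q^T.
  by rewrite !mulmxA QQt mul1mx -mulmxA QQt mulmx1.
rewrite procrustes_obj_conj // -(frobenius_isometry Y (_ : (Q^T)^T *m Q^T = 1%:M)) ?trmxK //.
exact: block_form_dist_ge.
Qed.

Lemma A_star_normal Q : orthogonal_mx Q -> normal_mx (A_star X Y Q).
Proof.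
move=> [QtQ QQt]; have := normal_block_form_normal (Delta_form (Q^T *m X) (Q^T *m Y)).
rewrite /normal_mx /A_star /Delta_star /=; set D := block_diag _ _ => normD.
rewrite !trmx_mul trmxK !mulmxA -(mulmxA _ Q^T Q) QtQ mulmx1.
by rewrite -(mulmxA _ Q^T Q) QtQ mulmx1 -!(mulmxA Q) normD.
Qed.

End Procrustes.

Theorem theorem5p4 (R : realType) (m n : nat) (X Y : 'M[R]_(m, n))
    (hn : (1 <= n)%N) (hmn : (n <= m)%N) (hX : X != 0) (hY : Y != 0) :
  (* the two expressions for g agree *)
  (forall Q : 'M[R]_m, orthogonal_mx Q ->
     g X Y Q = frobenius (Delta_star X Y Q *m (Q^T *m X)) ^+ 2) /\
  (* Delta_Q is an optimal block diagonal matrix for Q *)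
  (forall Q : 'M[R]_m, orthogonal_mx Q ->
     argmin (@normal_block_form R m)
       (fun D => frobenius (D *m (Q^T *m X) - Q^T *m Y) ^+ 2)
       (Delta_star X Y Q)) /\
  (* the optimal values of the two problems determine each other *)
  inf [set procrustes_obj X Y A | A in @normal_mx R m] =
    frobenius Y ^+ 2 - sup [set g X Y Q | Q in @orthogonal_mx R m] /\
  (* a maximizer of g is the same as an orthogonal Q for which A_Q is optimal *)
  (forall Q : 'M[R]_m, orthogonal_mx Q ->
     (argmax (@orthogonal_mx R m) (g X Y) Q <->
      argmin (@normal_mx R m) (procrustes_obj X Y) (A_star X Y Q))) /\
  (* every optimal A is block diagonalized by some maximizer of g *)
  (forall A : 'M[R]_m, argmin (@normal_mx R m) (procrustes_obj X Y) A ->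
     exists2 Q : 'M[R]_m, argmax (@orthogonal_mx R m) (g X Y) Q &
       normal_block_form (Q^T *m A *m Q)) /\
  (* the optimal A given by a maximizer of g is normal *)
  (forall Q : 'M[R]_m, argmax (@orthogonal_mx R m) (g X Y) Q ->
     normal_mx (A_star X Y Q) /\
     argmin (@normal_mx R m) (procrustes_obj X Y) (A_star X Y Q)).
Proof.
have real_form (A : 'M[R]_m) : normal_mx A ->
    exists2 Q, orthogonal_mx Q & frobenius Y ^+ 2 - g X Y Q <= procrustes_obj X Y A.
  by move=> /real_normal_form[Q orthQ formA]; exists Q => //; exact: procrustes_obj_ge.
have A_star_opt Q : argmax (@orthogonal_mx R m) (g X Y) Q ->
    argmin (@normal_mx R m) (procrustes_obj X Y) (A_star X Y Q).
  move=> [orthQ maxQ]; split=> [|A /real_form[Q' orthQ']]; first exact: A_star_normal.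
  by rewrite procrustes_obj_A_star //; apply: le_trans; rewrite lerD2l lerN2 maxQ.
split; first by move=> Q _; rewrite Delta_gain.
split.
  move=> Q _; split=> [|M formM]; first exact: Delta_form.
  by rewrite [leLHS]Delta_dist block_form_dist_ge.
split; last split; last split.
- have orth1 : orthogonal_mx (1%:M : 'M[R]_m) by rewrite /orthogonal_mx /= trmx1 mulmx1.
  have lb0 : has_lbound [set procrustes_obj X Y A | A in @normal_mx R m].
    by exists 0 => _ [A _ <-]; rewrite /procrustes_obj sqr_ge0.
  have ubY : has_ubound [set g X Y Q | Q in @orthogonal_mx R m].
    exists (frobenius Y ^+ 2) => _ [Q orthQ <-].
    by rewrite -subr_ge0 -procrustes_obj_A_star // sqr_ge0.
  apply/eqP; rewrite eq_le; apply/andP; split.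
    rewrite lerBrDr -lerBrDl; apply: ge_sup; first by exists (g X Y 1%:M), 1%:M.
    move=> _ [Q orthQ <-]; rewrite lerBrDl -lerBrDr -procrustes_obj_A_star //.
    by apply: ge_inf => //; exists (A_star X Y Q) => //; exact: A_star_normal.
  apply: lb_le_inf.
    exists (procrustes_obj X Y (A_star X Y 1%:M)), (A_star X Y 1%:M) => //.
    exact: A_star_normal.
  move=> _ [A /real_form[Q orthQ objA] <-]; apply: le_trans objA.
  by rewrite lerD2l lerN2; apply: ub_le_sup => //; exists Q.
- move=> Q orthQ; split=> [/A_star_opt //|[_ minA]]; split=> // Q' orthQ'.
  have := minA _ (A_star_normal X Y orthQ').
  by rewrite !procrustes_obj_A_star // lerD2l lerN2.
- move=> A [/real_normal_form[Q orthQ formA] minA]; exists Q => //; split=> // Q' orthQ'.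
  have := le_trans (procrustes_obj_ge X Y orthQ formA) (minA _ (A_star_normal X Y orthQ')).
  by rewrite procrustes_obj_A_star // lerD2l lerN2.
- move=> Q maxQ; split; last exact: A_star_opt.
  by case: maxQ => orthQ _; exact: A_star_normal.
Qed.
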